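(* Let $\mathcal X\subseteq\mathbb R^{D_x}$ be compact with $\sup_{x\in\mathcal X}\|x\|\le R_x$. Suppose there is a nondecreasing function $\varepsilon:\mathbb R_+\to\mathbb R_+$ of at most polynomial growth such that for every fixed $z\in\mathcal X$ and every $\delta\in(0,1)$, with probability at least $1-\delta$, $$\left|\mathbb E_{\mathbb P^\star}[\ell(z,\xi)]-\mathbb E_{\hat{\mathbb P}_N}[\ell(z,\xi)]\right|\le\frac1{\sqrt N}\,\varepsilon\!\left(\log\frac1\delta\right).$$ Let $L=\max_{j\in[J]}\|\mathbf A_j\|_{\mathrm{op}}\sqrt\Omega+\max_{j\in[J]}\|\mathbf b_j\|$, let $\delta\in(0,1)$, and set $$\epsilon=\frac1{\sqrt N}\left(\varepsilon\!\left(D_x\log\big(1+2R_xL\sqrt N\big)+\log\frac1\delta\right)+2\right).$$ Let $x^\star\in\arg\min_{x\in\mathcal X}\mathbb E_{\mathbb P^\star}[\ell(x,\xi)]$ and $\hat x\in\arg\min_{x\in\mathcal X}\sup_{\mathbb Q\in\mathcal P_\epsilon}\mathbb E_{\mathbb Q}[\ell(x,\xi)]$. Then, with probability at least $1-2\delta$, $$\mathbb E_{\mathbb P^\star}[\ell(\hat x,\xi)]\le\mathbb E_{\mathbb P^\star}[\ell(x^\star,\xi)]+\frac1{\sqrt N}\,\varepsilon\!\left(\log\frac1\delta\right)+\epsilon.$$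
   Context: The decision set $\mathcal X\subseteq\mathbb R^{D_x}$ is compact and convex, and $\Xi\subseteq\mathbb R^{D_\xi}$ is the support set of the random vector $\xi$; $\mathscr P(\Xi)$ is the set of probability distributions on $\Xi$. The loss is $\ell(x,\xi)=\max_{j\in[J]}\big(a_j(x)^\top\xi+b_j(x)\big)$ with $a_j(x)=\mathbf A_jx+\bar{\mathbf a}_j$ and $b_j(x)=\mathbf b_j^\top x+\bar b_j$, and $c_1,c_2\ge 0$ satisfy $|\ell(x,\xi)|\le c_1+c_2\|\xi\|$ for all $x\in\mathcal X$, $\xi\in\Xi$. $\mathbb P^\star$ is the true distribution; $\hat{\mathbb P}_N$ is a reference distribution on $\Xi$ constructed from $N$ random data points, and ''with probability'' refers to the randomness of the data. The constant $\Omega$ satisfies $\mathbb E_{\hat{\mathbb P}_N}[\|\xi\|^2]<\Omega$ and $\mathbb E_{\mathbb P^\star}[\|\xi\|^2]\le\Omega$. $\mathbb Z$ is a probability distribution with full support on $\mathcal X$, $[u]_+=\max\{u,0\}$, and $$\mathcal P_\epsilon=\Big\{\mathbb Q\in\mathscr P(\Xi):\ \mathbb E_{z\sim\mathbb Z}\big[\big[\mathbb E_{\mathbb Q}[\ell(z,\xi)]-\mathbb E_{\hat{\mathbb P}_N}[\ell(z,\xi)]-\epsilon\big]_+\big]\le 0,\ \mathbb E_{\mathbb Q}[\|\xi\|^2]\le\Omega\Big\}.$$ $\|\cdot\|$ is the Euclidean norm and $\|\cdot\|_{\mathrm{op}}$ the operator norm. Both minimizers $x^\star$ and $\hat x$ exist.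 *)

(* Defs.v *)
From HB Require Import structures.
From mathcomp Require Import all_boot all_order all_algebra.
From mathcomp Require Import all_classical all_reals all_analysis.

Set Implicit Arguments.
Unset Strict Implicit.
Unset Printing Implicit Defensive.

Import Order.TTheory GRing.Theory Num.Theory.
Import numFieldNormedType.Exports.

Local Open Scope classical_set_scope.
Local Open Scope ring_scope.

(* Column vectors carry the Borel sigma-algebra of their usual topology, so
   that [probability 'cV[R]_n R] is the type of Borel probability measures on
   R^n. *)
HB.instance Definition _ (R : realType) (n : nat) :=
  @isMeasurable.Build (sigma_display (@open 'cV[R]_n)) 'cV[R]_n
    <<s @open 'cV[R]_n >>
    (@sigma_algebra0 _ setT _) (@sigma_algebraC _ _)
    (@sigma_algebra_bigcup _ setT _).

Section vectors.
Context {R : realType}.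

Definition dotv n (u v : 'cV[R]_n) : R := \sum_i u i ord0 * v i ord0.

(* The library norm `|v| on matrices is the sup norm, hence this definition. *)
Definition l2norm n (v : 'cV[R]_n) : R := Num.sqrt (\sum_i v i ord0 ^+ 2).

Definition opnorm m n (A : 'M[R]_(m, n)) : R :=
  sup [set l2norm (A *m v) | v in [set v : 'cV[R]_n | l2norm v <= 1]].

(* Maximum of a nonempty family, hence the index type 'I_J.+1. *)
Definition maxI J (f : 'I_J.+1 -> R) : R := \big[Num.max/f ord0]_j f j.

Definition loss J Dx Dxi
    (A : 'I_J.+1 -> 'M[R]_(Dxi, Dx)) (abar : 'I_J.+1 -> 'cV[R]_Dxi)
    (b : 'I_J.+1 -> 'cV[R]_Dx) (bbar : 'I_J.+1 -> R)
    (x : 'cV[R]_Dx) (xi : 'cV[R]_Dxi) : R :=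
  maxI (fun j => dotv (A j *m x + abar j) xi + (dotv (b j) x + bbar j)).

Definition second_moment n (Q : probability 'cV[R]_n R) : \bar R :=
  'E_Q[fun xi => l2norm xi ^+ 2].

Definition msupport n (Q : probability 'cV[R]_n R) : set 'cV[R]_n :=
  [set x | forall U, open U -> U x -> (0 < Q U)%E].

Definition full_support_on n (X : set 'cV[R]_n) (Z : probability 'cV[R]_n R) :=
  Z X = 1%E /\ msupport Z = X.

Definition ambiguity_set Dx Dxi
    (X : set 'cV[R]_Dx) (Xi : set 'cV[R]_Dxi) (Z : probability 'cV[R]_Dx R)
    (ell : 'cV[R]_Dx -> 'cV[R]_Dxi -> R) (Phat : probability 'cV[R]_Dxi R)
    (Omega eps : R) : set (probability 'cV[R]_Dxi R) :=
  [set Q : probability 'cV[R]_Dxi R | [/\ Q Xi = 1%E,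
     (\int[Z]_(z in X)
        maxe ('E_Q[ell z] - 'E_Phat[ell z] - eps%:E) 0 <= 0)%E
   & (second_moment Q <= Omega%:E)%E]].

End vectors.

Definition argmin (R : realType) (T : Type) (X : set T) (f : T -> \bar R) :=
  [set x | X x /\ forall y, X y -> (f x <= f y)%E].

(* "A holds with P-probability at least p": for measurable A this is
   p <= P A, and it also makes sense without knowing that A is measurable. *)
Definition with_prob_ge (R : realType) d (T : measurableType d)
    (P : probability T R) (p : R) (A : set T) :=
  exists2 E, measurable E & E `<=` A /\ (p%:E <= P E)%E.

Definition poly_growth (R : realType) (f : R -> R) :=
  exists (C : R) (k : nat), forall t, 0 <= t -> f t <= C * (1 + t ^+ k).

(* Main.v *)
Require Import Defs.
From HB Require Import structures.
From mathcomp Require Import all_boot all_order all_algebra.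
From mathcomp Require Import all_classical all_reals all_analysis.
From mathcomp Require Import measurable_realfun ring lra.

Set Implicit Arguments.
Unset Strict Implicit.
Unset Printing Implicit Defensive.

Import Order.TTheory GRing.Theory Num.Theory.
Import numFieldNormedType.Exports.

Local Open Scope classical_set_scope.
Local Open Scope ring_scope.

(** With high probability the true distribution [Pstar] belongs to the ambiguity
set. On that event the robust objective at [xhat w] dominates the true risk of
[xhat w]; by minimality it is at most the robust objective at [xstar], which
never exceeds the reference risk of [xstar] by more than [eps]; and the
concentration bound at the single point [xstar] turns the reference risk into
the true one. The two events, membership of [Pstar] and concentration at
[xstar], each fail with probability at most [delta].

That [Pstar] is in the ambiguity set requires concentration at all decisions
simultaneously. For any distribution with second moment at most [Omega], the
expected loss is [L]-Lipschitz in the decision ([expected_loss_lipschitz]), so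
it is enough to control a net of [X] on which [L] times the mesh is at most
[1 / sqrt N]: the two mesh errors, one for [Pstar] and one for the reference,
are the [2] in [eps]. The net has at most [(1 + 2 Rx L sqrt N) ^ Dx] points
([exists_lipschitz_net]) and the union bound, run at confidence [delta / K] for
a net of [K] points, produces the argument of [rate] in [eps]. The cardinality
estimate is usually a comparison of volumes of Euclidean balls; here it is
obtained without volumes, by a tensor-power argument ([packing_bound]).

A member [Q] of the ambiguity set satisfies [E_Q ell <= E_Phat ell + eps] at
[xstar] itself, and not only almost everywhere for [Z], because the excess is
continuous in the decision and [Z] charges every neighbourhood of a point of [X]
([le0_of_integral_pospart_le0]). *)

(** * Euclidean and operator norms *)

Section euclidean.
Context {R : realType}.
Implicit Types n m : nat.

Lemma l2norm_ge0 n (v : 'cV[R]_n) : 0 <= l2norm v.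
Proof. exact: sqrtr_ge0. Qed.

Lemma sqr_l2norm n (v : 'cV[R]_n) : l2norm v ^+ 2 = \sum_i v i ord0 ^+ 2.
Proof. by rewrite sqr_sqrtr// sumr_ge0// => i _; exact: sqr_ge0. Qed.

Lemma l2norm0 n : l2norm (0 : 'cV[R]_n) = 0.
Proof.
by rewrite /l2norm big1 ?sqrtr0// => i _; rewrite mxE expr0n.
Qed.

Lemma l2normZ n (a : R) (v : 'cV[R]_n) : l2norm (a *: v) = `|a| * l2norm v.
Proof.
rewrite /l2norm -sqrtr_sqr -sqrtrM ?sqr_ge0// mulr_sumr.
by congr Num.sqrt; apply: eq_bigr => i _; rewrite mxE exprMn.
Qed.

Lemma l2normN n (v : 'cV[R]_n) : l2norm (- v) = l2norm v.
Proof. by rewrite -scaleN1r l2normZ normrN1 mul1r. Qed.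

Lemma l2norm_distC n (u v : 'cV[R]_n) : l2norm (u - v) = l2norm (v - u).
Proof. by rewrite -l2normN opprB. Qed.

Lemma l2norm_eq0 n (v : 'cV[R]_n) : l2norm v = 0 -> v = 0.
Proof.
move=> v0; have /eqP := sqr_l2norm v.
rewrite v0 expr0n eq_sym psumr_eq0 => [/allP h|i _]; last exact: sqr_ge0.
apply/matrixP => i j; rewrite ord1 mxE; apply/eqP.
by have := h i (mem_index_enum _); rewrite /= sqrf_eq0.
Qed.

Lemma dotvDl n (u v w : 'cV[R]_n) : dotv (u + v) w = dotv u w + dotv v w.
Proof.
by rewrite -big_split; apply: eq_bigr => i _; rewrite mxE mulrDl.
Qed.

Lemma dotvZl n a (u v : 'cV[R]_n) : dotv (a *: u) v = a * dotv u v.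
Proof.
by rewrite mulr_sumr; apply: eq_bigr => i _; rewrite mxE mulrA.
Qed.

Lemma dotvBl n (u v w : 'cV[R]_n) : dotv (u - v) w = dotv u w - dotv v w.
Proof. by rewrite -scaleN1r dotvDl dotvZl mulN1r. Qed.

Lemma dotvC n (u v : 'cV[R]_n) : dotv u v = dotv v u.
Proof. by apply: eq_bigr => i _; rewrite mulrC. Qed.

Lemma dotvv n (u : 'cV[R]_n) : dotv u u = l2norm u ^+ 2.
Proof. by rewrite sqr_l2norm; apply: eq_bigr => i _; rewrite expr2. Qed.

Lemma dotv0l n (u : 'cV[R]_n) : dotv 0 u = 0.
Proof. by apply: big1 => i _; rewrite mxE mul0r. Qed.

Lemma dotv_le n (u v : 'cV[R]_n) : dotv u v <= l2norm u * l2norm v.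
Proof.
have [u0|u0] := eqVneq (l2norm u) 0.
  by rewrite (l2norm_eq0 u0) dotv0l l2norm0 mul0r.
have [v0|v0] := eqVneq (l2norm v) 0.
  by rewrite (l2norm_eq0 v0) dotvC dotv0l l2norm0 mulr0.
set a := l2norm u; set b := l2norm v.
have a0 : 0 < a by rewrite lt_def u0 l2norm_ge0.
have b0 : 0 < b by rewrite lt_def v0 l2norm_ge0.
(* expand |b u - a v|^2 >= 0 *)
have : 0 <= dotv (b *: u - a *: v) (b *: u - a *: v).
  by rewrite dotvv sqr_ge0.
rewrite dotvBl !dotvZl !(dotvC _ (_ - _)) !dotvBl !dotvZl !dotvv (dotvC v u).
rewrite -/a -/b.
have -> : b * (b * a ^+ 2 - a * dotv u v) - a * (b * dotv u v - a * b ^+ 2) =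
  2 * (a * b) * (a * b - dotv u v) by ring.
by rewrite pmulr_rge0 ?subr_ge0// mulr_gt0// mulr_gt0.
Qed.

Lemma cauchy_schwarz n (u v : 'cV[R]_n) : `|dotv u v| <= l2norm u * l2norm v.
Proof.
rewrite ler_norml dotv_le andbT lerNl.
by rewrite -mulN1r -dotvZl scaleN1r -(l2normN u) dotv_le.
Qed.

Lemma l2normD n (u v : 'cV[R]_n) : l2norm (u + v) <= l2norm u + l2norm v.
Proof.
rewrite -(@ler_pXn2r _ 2) ?nnegrE ?addr_ge0 ?l2norm_ge0//.
rewrite -dotvv dotvDl !(dotvC _ (_ + _)) !dotvDl !dotvv (dotvC v u).
by have := dotv_le u v; lra.
Qed.

Lemma l2normB n (u v : 'cV[R]_n) : l2norm (u - v) <= l2norm u + l2norm v.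
Proof. by rewrite -(l2normN v); exact: l2normD. Qed.

Lemma l2norm_sum n (I : Type) (s : seq I) (F : I -> 'cV[R]_n) :
  l2norm (\sum_(i <- s) F i) <= \sum_(i <- s) l2norm (F i).
Proof.
elim/big_ind2: _ => [|u a v b ua vb|//]; first by rewrite l2norm0.
exact: le_trans (l2normD _ _) (lerD ua vb).
Qed.

Lemma coord_le_l2norm n (v : 'cV[R]_n) i : `|v i ord0| <= l2norm v.
Proof.
rewrite -sqrtr_sqr ler_sqrt; last by rewrite sumr_ge0// => j _; exact: sqr_ge0.
by rewrite (bigD1 i)//= lerDl sumr_ge0// => j _; exact: sqr_ge0.
Qed.

Lemma l2norm_continuous n : continuous (@l2norm R n).
Proof.
move=> v; apply: (@continuous_comp _ _ _ (fun v : 'cV[R]_n => \sum_i v i ord0 ^+ 2)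
  Num.sqrt); last exact: sqrt_continuous.
apply: continuous_big => [|i _ {}v]; first exact: add_continuous.
have vi := @coord_continuous R n 1 i ord0 v.
exact: (cvgM vi vi).
Qed.

(** Finiteness of the supremum defining [opnorm]: the columns of [A] give a
crude bound on the image of the unit ball. *)
Lemma opnorm_has_ubound m n (A : 'M[R]_(m, n)) :
  has_ubound [set l2norm (A *m v) | v in [set v : 'cV[R]_n | l2norm v <= 1]].
Proof.
exists (\sum_j l2norm (col j A)) => _ [v v1 <-].
have -> : A *m v = \sum_j v j ord0 *: col j A.
  apply/matrixP => i k; rewrite mxE summxE; apply: eq_bigr => j _.
  by rewrite !mxE ord1 mulrC.
apply: le_trans (l2norm_sum _ _) _; apply: ler_sum => j _.
rewrite l2normZ ler_piMl ?l2norm_ge0//.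
exact: le_trans (coord_le_l2norm _ _) v1.
Qed.

Lemma opnorm_ge0 m n (A : 'M[R]_(m, n)) : 0 <= opnorm A.
Proof.
apply: le_trans (ub_le_sup (opnorm_has_ubound A) _); last first.
  by exists 0; [rewrite /= l2norm0|reflexivity].
exact: l2norm_ge0.
Qed.

Lemma l2norm_mulmx m n (A : 'M[R]_(m, n)) v :
  l2norm (A *m v) <= opnorm A * l2norm v.
Proof.
have [v0|v0] := eqVneq (l2norm v) 0.
  by rewrite (l2norm_eq0 v0) mulmx0 !l2norm0 mulr0.
have v_gt0 : 0 < l2norm v by rewrite lt_def v0 l2norm_ge0.
rewrite -ler_pdivrMr// mulrC -(gtr0_norm (_ : 0 < (l2norm v)^-1)) ?invr_gt0//.
rewrite -l2normZ scalemxAr; apply: (ub_le_sup (opnorm_has_ubound A)).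
by eexists; last reflexivity; rewrite /= l2normZ gtr0_norm ?invr_gt0// mulVf.
Qed.

End euclidean.

(** * Packing numbers and nets of Euclidean balls *)

Section packing.
Context {R : realType} {D : nat}.
Implicit Types (eta r : R).

Definition separated eta (I : Type) (x : I -> 'cV[R]_D) :=
  forall i j, i <> j -> eta <= l2norm (x i - x j).

(** Pigeonhole on a cubic grid: with mesh [eta / D.+1] a cell has diameter less
than [eta], so it holds at most one point of the family. The radius has the form
that [iterated_packing] produces; [ler_of_pow_bound] later removes the factor
[D.+1 ^ D]. *)
Lemma crude_packing_bound eta (q : R) (I : finType) (x : I -> 'cV[R]_D) :
  0 < eta -> 1 <= q -> separated eta x ->
  (forall i, l2norm (x i) <= eta / 2 * (q - 1)) ->
  #|I|%:R <= (D.+1%:R * q) ^+ D :> R.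
Proof.
move=> eta0 q1 sepx xle.
have D0 : 0 < D.+1%:R :> R by rewrite ltr0n.
set h := eta / D.+1%:R; have h0 : 0 < h by rewrite divr_gt0.
set M := eta / 2 * (q - 1).
have M0 : 0 <= M by rewrite mulr_ge0 ?subr_ge0// ltW// divr_gt0.
(* Shifting by M makes the coordinates nonnegative, so truncation is the floor. *)
set N := Num.truncn (2 * M / h).
pose cell i k := Num.truncn ((x i k ord0 + M) / h).
have cell_ge0 i k : 0 <= (x i k ord0 + M) / h.
  apply: divr_ge0; last exact: ltW.
  by have := le_trans (coord_le_l2norm (x i) k) (xle i); rewrite -/M ler_norml; lra.
have cell_lt i k : (cell i k < N.+1)%N.
  rewrite ltnS; apply: le_truncn; rewrite ler_pM2r ?invr_gt0//.
  by have := le_trans (coord_le_l2norm (x i) k) (xle i); rewrite -/M ler_norml; lra.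
pose f i : {ffun 'I_D -> 'I_N.+1} := [ffun k => Ordinal (cell_lt i k)].
have f_inj : injective f.
  move=> i j fij; apply: contrapT => ij; have := sepx _ _ ij.
  apply/negP; rewrite -ltNge -(@ltr_pXn2r _ 2) ?nnegrE ?l2norm_ge0 ?(ltW eta0)//.
  rewrite sqr_l2norm.
  have dist_le k : (x i - x j) k ord0 ^+ 2 <= h ^+ 2.
    rewrite -real_normK ?num_real// ler_pXn2r ?nnegrE ?normr_ge0 ?(ltW h0)//.
    have cij : cell i k = cell j k.
      by have := congr1 (fun g : {ffun 'I_D -> 'I_N.+1} => val (g k)) fij; rewrite !ffunE.
    have := truncn_itv (cell_ge0 i k); have := truncn_itv (cell_ge0 j k).
    rewrite -/(cell i k) -/(cell j k) cij => /andP[j1 j2] /andP[i1 i2].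
    have -> : (x i - x j) k ord0 =
      ((x i k ord0 + M) / h - (x j k ord0 + M) / h) * h.
      by rewrite !mxE; field; exact: lt0r_neq0.
    rewrite normrM (gtr0_norm h0) ler_piMl ?(ltW h0)// ler_norml.
    by rewrite -!natr1 in i2 j2; lra.
  apply: (@le_lt_trans _ _ (D%:R * h ^+ 2)).
    apply: le_trans (ler_sum _ (fun k _ => dist_le k)) _.
    by rewrite sumr_const card_ord mulr_natl.
  rewrite /h expr_div_n mulrCA gtr_pMr ?exprn_gt0// ltr_pdivrMr ?exprn_gt0// mul1r.
  by rewrite -natrX ltr_nat; apply: leq_trans (leq_pmulr _ _).
have := leq_card f f_inj.
rewrite card_ffun !card_ord -(ler_nat R) natrX => /le_trans; apply.
apply: lerXn2r; rewrite ?nnegrE ?ler0n ?mulr_ge0 ?ler0n ?(le_trans ler01 q1)//.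
have : N%:R <= 2 * M / h
  by rewrite truncn_le; apply: divr_ge0 (mulr_ge0 _ M0) (ltW h0).
have -> : 2 * M / h = D.+1%:R * (q - 1).
  by rewrite /h /M; field; rewrite ?lt0r_neq0 ?pnatr_eq0.
have : 1 <= D.+1%:R :> R by rewrite ler1n.
by rewrite -(natr1 N) mulrBr; lra.
Qed.

(** The digits construction behind the tensor-power trick: placing a scaled
packing [rho ^+ m *: x i] and repeating the smaller configuration around each
of its points keeps the separation [eta], and [rho] is exactly the factor that
makes the radii telescope. *)
Lemma iterated_packing eta r (I : finType) (x : I -> 'cV[R]_D) m :
  0 < eta -> 0 <= r -> separated eta x -> (forall i, l2norm (x i) <= r) ->
  let rho := 1 + 2 * r / eta in
  exists (J : finType) (y : J -> 'cV[R]_D), [/\ #|J| = (#|I| ^ m)%N,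
    separated eta y & forall j, l2norm (y j) <= eta / 2 * (rho ^+ m - 1)].
Proof.
move=> eta0 r0 sepx xr rho.
have rho1 : 1 <= rho by rewrite lerDl divr_ge0 ?(ltW eta0)// mulr_ge0.
have r_rho : r = eta / 2 * (rho - 1).
  by rewrite /rho; field; exact: lt0r_neq0.
elim: m => [|m [J [y [cardJ sepy yle]]]].
  exists unit, (fun=> 0); split; first by rewrite card_unit.
    by move=> [] [].
  by move=> _; rewrite l2norm0 subrr mulr0.
have rhom : 0 < rho ^+ m by rewrite exprn_gt0// (lt_le_trans ltr01).
exists (I * J)%type, (fun p => rho ^+ m *: x p.1 + y p.2); split.
- by rewrite card_prod cardJ expnS.
- move=> [i j] [i' j'] /= neq.
  have -> : rho ^+ m *: x i + y j - (rho ^+ m *: x i' + y j') =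
      rho ^+ m *: (x i - x i') + (y j - y j').
    by rewrite scalerBr opprD addrACA.
  have [ii'|ii'] := pselect (i = i').
    rewrite ii' subrr scaler0 add0r; apply: sepy => jj'.
    by apply: neq; rewrite ii' jj'.
  (* The leading digits differ: they are at least rho ^ m eta apart, and the lower
     digits together compensate for at most (rho ^ m - 1) eta. *)
  have le1 : rho ^+ m * eta <= l2norm (rho ^+ m *: (x i - x i')).
    by rewrite l2normZ gtr0_norm// ler_pM2l//; exact: sepx.
  have le2 : l2norm (rho ^+ m *: (x i - x i')) <=
      l2norm (rho ^+ m *: (x i - x i') + (y j - y j')) + l2norm (y j - y j').
    by rewrite -{1}(addrK (y j - y j') (_ *: _)) l2normB.
  have := l2normB (y j) (y j'); have := yle j; have := yle j'.
  by move: le1 le2; lra.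
- move=> [i j] /=; apply: le_trans (l2normD _ _) _.
  rewrite l2normZ gtr0_norm//.
  apply: le_trans (lerD (ler_wpM2l (ltW rhom) (xr i)) (yle j)) _.
  by rewrite r_rho exprS; lra.
Qed.

(** If [b < a], the powers of [a / b] grow at least linearly (Bernoulli's
inequality) and exceed any [C]. *)
Lemma ler_of_pow_bound (a b C : R) : 0 <= a -> 0 < b ->
  (forall m, a ^+ m <= C * b ^+ m) -> a <= b.
Proof.
move=> a0 b0 H; rewrite leNgt; apply/negP => ba.
set u := a / b - 1; have u0 : 0 < u by rewrite subr_gt0 ltr_pdivlMr// mul1r.
have bernoulli m : 1 + m%:R * u <= (1 + u) ^+ m.
  elim: m => [|m IH]; first by rewrite mul0r addr0 expr0.
  rewrite exprS -natr1.
  apply: le_trans (ler_wpM2l (_ : 0 <= 1 + u) IH); last by rewrite addr_ge0// ltW.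
  have : 0 <= m%:R * u * u by rewrite !mulr_ge0// ltW.
  by lra.
have bound m : m%:R * u <= C.
  apply: le_trans (_ : (1 + u) ^+ m <= _); first by have := bernoulli m; lra.
  by rewrite /u addrC subrK expr_div_n ler_pdivrMr ?exprn_gt0.
have := bound (Num.truncn (C / u)).+1.
by rewrite leNgt -ltr_pdivrMr// truncnS_gt.
Qed.

(** Volume comparison would give this bound (disjoint balls of radius [eta / 2]
inside the ball of radius [r + eta / 2]). Iterating the packing [m] times turns
the crude cube count, which loses a constant factor, into
[#|I| ^ m <= C rho ^ (m D)], and the constant disappears as [m] grows. *)
Lemma packing_bound eta r (I : finType) (x : I -> 'cV[R]_D) :
  0 < eta -> 0 <= r -> separated eta x -> (forall i, l2norm (x i) <= r) ->
  #|I|%:R <= (1 + 2 * r / eta) ^+ D.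
Proof.
move=> eta0 r0 sepx xr.
have rho1 : 1 <= 1 + 2 * r / eta by rewrite lerDl divr_ge0 ?(ltW eta0)// mulr_ge0.
apply: (@ler_of_pow_bound _ _ (D.+1%:R ^+ D)) => [||m]; first exact: ler0n.
  by rewrite exprn_gt0// (lt_le_trans ltr01).
have [J [y [cardJ sepy yle]]] := iterated_packing m eta0 r0 sepx xr.
rewrite -[leLHS]natrX -cardJ.
apply: le_trans (crude_packing_bound eta0 _ sepy yle) _; first exact: exprn_ege1.
by rewrite exprMn -!exprM mulnC.
Qed.

(** [packing_bound] makes a separated family of maximal cardinality exist, and
such a family is a net: a point far from all its members could be added. *)
Lemma exists_net eta r (X : set 'cV[R]_D) : 0 < eta -> 0 <= r ->
  (forall z, X z -> l2norm z <= r) ->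
  exists (K : nat) (x : 'I_K -> 'cV[R]_D),
  [/\ K%:R <= (1 + 2 * r / eta) ^+ D, forall i, X (x i)
    & forall z, X z -> exists i, l2norm (z - x i) <= eta].
Proof.
move=> eta0 r0 Xr.
pose P K := `[< exists x : 'I_K -> 'cV[R]_D,
  (forall i, X (x i)) /\ separated eta x >].
have P_bound K : P K -> K%:R <= (1 + 2 * r / eta) ^+ D.
  move=> /asboolP[x [Xx sepx]].
  by rewrite -[K]card_ord; apply: packing_bound sepx _ => // i; exact: Xr.
have P0 : exists K, P K.
  by exists 0%N; apply/asboolP; exists (fun=> 0); split=> [[]|[]].
have P_le K : P K -> (K <= Num.truncn ((1 + 2 * r / eta) ^+ D))%N.
  move=> /P_bound PK; rewrite truncn_ge_nat// exprn_ge0// addr_ge0//.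
  by rewrite divr_ge0 ?(ltW eta0)// mulr_ge0.
case: (ex_maxnP P0 P_le) => K PK maxK.
have := PK => /asboolP[x [Xx sepx]]; exists K, x; split=> //; first exact: P_bound.
move=> z Xz; apply: contrapT => far.
have far' i : eta <= l2norm (z - x i).
  by rewrite leNgt; apply/negP => /ltW le; apply: far; exists i.
suff /maxK : P K.+1 by rewrite ltnn.
apply/asboolP; exists (fun i => if unlift ord0 i is Some j then x j else z).
split=> [i|i j]; first by case: unliftP.
case: unliftP => [i'|] ->; case: unliftP => [j'|] -> // neq.
- by apply: sepx => ij; apply: neq; rewrite ij.
- by rewrite l2norm_distC.
Qed.

(** The net is measured in the scale of an [L]-Lipschitz function: [L] times the
mesh is at most [1 / t]. The mesh is then [1 / (L t)], except that for [L = 0] a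
single point is a net. *)
Lemma exists_lipschitz_net (L t r : R) (X : set 'cV[R]_D) x0 :
  0 <= L -> 0 < t -> X x0 -> (forall z, X z -> l2norm z <= r) ->
  exists (K : nat) (x : 'I_K -> 'cV[R]_D),
  [/\ K%:R <= (1 + 2 * r * L * t) ^+ D, forall i, X (x i)
    & forall z, X z -> exists i, L * l2norm (z - x i) <= t^-1].
Proof.
move=> L0 t0 Xx0 Xr; have r0 : 0 <= r := le_trans (l2norm_ge0 x0) (Xr _ Xx0).
have [->|Lneq0] := eqVneq L 0.
  exists 1%N, (fun=> x0); split=> //; first by rewrite mulr0 mul0r addr0 expr1n.
  by move=> z _; exists ord0; rewrite mul0r invr_ge0 ltW.
have L_gt0 : 0 < L by rewrite lt_def Lneq0.
have eta0 : 0 < (L * t)^-1 by rewrite invr_gt0 mulr_gt0.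
have [K [x [Kle Xx net]]] := exists_net eta0 r0 Xr.
exists K, x; split=> //; first by move: Kle; rewrite invrK mulrA.
move=> z /net[i le]; exists i; rewrite mulrC -ler_pdivlMr//.
by rewrite -invfM (mulrC t).
Qed.

End packing.

(** * Finite maxima *)

Section maximum.
Context {R : realType} {J : nat}.
Implicit Types f g : 'I_J.+1 -> R.

Lemma maxI_ge f j : f j <= maxI f.
Proof. exact: le_bigmax. Qed.

Lemma maxI_le f c : (forall j, f j <= c) -> maxI f <= c.
Proof. by move=> fc; apply: bigmax_le. Qed.

Lemma maxI_ge0 f : (forall j, 0 <= f j) -> 0 <= maxI f.
Proof. by move=> f0; exact: le_trans (f0 ord0) (maxI_ge f ord0). Qed.

Lemma maxI_dist f g c : (forall j, `|f j - g j| <= c) -> `|maxI f - maxI g| <= c.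
Proof.
move=> fgc.
have fg : maxI f <= maxI g + c.
  by apply: maxI_le => j; have := fgc j; have := maxI_ge g j; rewrite ler_norml; lra.
have gf : maxI g <= maxI f + c.
  by apply: maxI_le => j; have := fgc j; have := maxI_ge f j; rewrite ler_norml; lra.
by rewrite ler_norml; apply/andP; split; lra.
Qed.

End maximum.

(** * Continuity and Borel measurability on column vectors *)

Section borel_vectors.
Context {R : realType} {n : nat}.

Lemma open_measurable_cV (U : set 'cV[R]_n) : open U -> measurable U.
Proof. by move=> oU; exact: sub_sigma_algebra. Qed.

Lemma compact_measurable_cV (X : set 'cV[R]_n) : compact X -> measurable X.
Proof.
move=> /(compact_closed (@norm_hausdorff _ _)) /closed_openC /open_measurable_cV.
by move=> /measurableC; rewrite setCK.
Qed.

Lemma continuous_measurable_cV (f : 'cV[R]_n -> R) :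
  continuous f -> measurable_fun setT f.
Proof.
move=> /continuousP cf; apply: (measurability _ (RGenOpens.measurableE R)).
move=> _ [_ [a [b ->] <-]]; rewrite setTI; apply: open_measurable_cV.
exact/cf/interval_open.
Qed.

(** The norm of the canonical topology on column vectors is the sup norm;
continuity of the Euclidean norm transfers Euclidean Lipschitz bounds to it. *)
Lemma lipschitz_continuous_cV (f : 'cV[R]_n -> R) (c : R) :
  (forall x y, `|f x - f y| <= c * l2norm (x - y)) -> continuous f.
Proof.
move=> fc x; apply/(@cvgrPdist_le _ _ _ _ (nbhs_filter x)) => e e0.
have dist_cont : continuous (fun y : 'cV[R]_n => l2norm (x - y)).
  move=> y; apply: (@continuous_comp _ _ _ (fun y : 'cV[R]_n => x - y));
    last exact: l2norm_continuous.
  by apply: continuousB => [|]; [exact: cst_continuous|exact: cvg_id].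
have Fx := nbhs_filter x.
have dist0 := cvgM (cvg_cst `|c|) (dist_cont x).
rewrite /= subrr l2norm0 mulr0 in dist0.
have := (@cvgrPdist_le _ _ _ _ Fx _ _).1 (dist0 Fx Fx) _ e0.
apply: filterS => y; rewrite sub0r normrN => le; apply: le_trans le.
apply: le_trans (fc x y) _; apply: le_trans (ler_norm _) _.
by rewrite normrM [leRHS]normrM normr_id.
Qed.

Lemma measurable_l2norm : measurable_fun setT (@l2norm R n).
Proof. exact: continuous_measurable_cV (@l2norm_continuous R n). Qed.

End borel_vectors.

(** * Lipschitz estimates for the loss and its expectation *)

Section loss_regularity.
Context {R : realType} {J Dx Dxi : nat}.
Variables (A : 'I_J.+1 -> 'M[R]_(Dxi, Dx)) (abar : 'I_J.+1 -> 'cV[R]_Dxi).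
Variables (b : 'I_J.+1 -> 'cV[R]_Dx) (bbar : 'I_J.+1 -> R).
Let ell := loss A abar b bbar.

(** A maximum moves by no more than its most sensitive entry, and the slope of
each affine piece in the decision grows linearly with the parameter. *)
Lemma loss_dist_decision x y xi : `|ell x xi - ell y xi| <=
  (maxI (fun j => opnorm (A j)) * l2norm xi + maxI (fun j => l2norm (b j)))
  * l2norm (x - y).
Proof.
apply: maxI_dist => j.
have -> : dotv (A j *m x + abar j) xi + (dotv (b j) x + bbar j) -
    (dotv (A j *m y + abar j) xi + (dotv (b j) y + bbar j)) =
    dotv (A j *m (x - y)) xi + dotv (b j) (x - y).
  rewrite !(dotvC (b j)) mulmxBr !dotvBl !dotvDl; ring.
rewrite mulrDl; apply: le_trans (ler_normD _ _) (lerD _ _).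
  apply: le_trans (cauchy_schwarz _ _) _.
  rewrite mulrAC ler_wpM2r ?l2norm_ge0//.
  apply: le_trans (l2norm_mulmx _ _) _.
  by rewrite ler_wpM2r ?l2norm_ge0//; exact: (maxI_ge (fun j => opnorm (A j))).
apply: le_trans (cauchy_schwarz _ _) _.
by rewrite ler_wpM2r ?l2norm_ge0//; exact: (maxI_ge (fun j => l2norm (b j))).
Qed.

(** Used for measurability of the loss and for its linear growth, hence its
integrability against distributions with a finite second moment. *)
Lemma loss_dist_parameter x xi xi' : `|ell x xi - ell x xi'| <=
  maxI (fun j => l2norm (A j *m x + abar j)) * l2norm (xi - xi').
Proof.
apply: maxI_dist => j; set a := A j *m x + abar j.
have -> : dotv a xi + (dotv (b j) x + bbar j) -
    (dotv a xi' + (dotv (b j) x + bbar j)) = dotv a (xi - xi').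
  by rewrite !(dotvC a) dotvBl; ring.
apply: le_trans (cauchy_schwarz _ _) _; rewrite ler_wpM2r ?l2norm_ge0//.
exact: (maxI_ge (fun j => l2norm (A j *m x + abar j))).
Qed.

Lemma measurable_loss x : measurable_fun setT (ell x).
Proof.
apply: continuous_measurable_cV.
by apply: lipschitz_continuous_cV => xi xi'; exact: loss_dist_parameter.
Qed.

Lemma loss_growth x xi : `|ell x xi| <=
  `|ell x 0| + maxI (fun j => l2norm (A j *m x + abar j)) * l2norm xi.
Proof.
have := loss_dist_parameter x xi 0; rewrite subr0 => le.
by rewrite -(subrK (ell x 0) (ell x xi)) addrC; apply: le_trans (ler_normD _ _) (lerD _ _).
Qed.

End loss_regularity.

Section expected_loss.
Context {R : realType} {n : nat}.
Variables (Q : probability 'cV[R]_n R) (Omega : R).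
Hypothesis second_moment_le : (second_moment Q <= Omega%:E)%E.

Lemma integrable_sqr_l2norm : Q.-integrable setT (EFin \o (fun xi => l2norm xi ^+ 2)).
Proof.
have mf : measurable_fun setT (fun xi : 'cV[R]_n => l2norm xi ^+ 2).
  exact: measurable_funX measurable_l2norm.
apply/integrableP; split; first exact/measurable_EFinP.
apply: le_lt_trans (ltry Omega); move: second_moment_le.
rewrite /second_moment unlock; apply: le_trans.
by under eq_integral do rewrite /= ger0_norm ?sqr_ge0//.
Qed.

Lemma integrable_l2norm : Q.-integrable setT (EFin \o @l2norm R n).
Proof.
(* r <= 1 + r ^ 2 *)
have int1 : Q.-integrable setT (EFin \o (fun xi => 1 + l2norm xi ^+ 2)).
  exact: (integrableD measurableT (finite_measure_integrable_cst Q 1 measurableT)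
    integrable_sqr_l2norm).
apply: le_integrable int1 => //.
  by apply/measurable_EFinP; exact: measurable_l2norm.
move=> xi _; rewrite !abse_EFin lee_fin ger0_norm ?l2norm_ge0//.
apply: le_trans (ler_norm _).
by have := sqr_ge0 (l2norm xi - 1); have := l2norm_ge0 xi; rewrite sqrrB1; lra.
Qed.

(** Jensen's inequality for the square, read off from
[0 <= E (|xi| - E |xi|) ^+ 2]. *)
Lemma mean_l2norm_le : \int[Q]_xi l2norm xi <= Num.sqrt Omega.
Proof.
set m := \int[Q]_xi l2norm xi.
have m0 : 0 <= m by apply: Rintegral_ge0 => xi _; exact: l2norm_ge0.
have Q1 : fine (Q setT) = 1 by rewrite probability_setT.
have sqrOmega : \int[Q]_xi l2norm xi ^+ 2 <= Omega.
  rewrite -lee_fin /Rintegral fineK; last exact: (integrable_fin_num measurableT integrable_sqr_l2norm).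
  by move: second_moment_le; rewrite /second_moment unlock.
have : 2 * m * m <= m ^+ 2 + Omega.
  rewrite {2}/m -RintegralZl//; last exact: integrable_l2norm.
  apply: le_trans (_ : \int[Q]_xi (m ^+ 2 + l2norm xi ^+ 2) <= _).
    apply: le_Rintegral => //.
    - exact: (integrableZl measurableT _ integrable_l2norm).
    - exact: (integrableD measurableT
        (finite_measure_integrable_cst Q _ measurableT) integrable_sqr_l2norm).
    - by move=> xi _; have := sqr_ge0 (m - l2norm xi); rewrite sqrrB; lra.
  rewrite RintegralD//; last exact: integrable_sqr_l2norm.
    by rewrite Rintegral_cst// Q1 mulr1 lerD2l.
  exact: finite_measure_integrable_cst.
move=> le; have le2 : m ^+ 2 <= Omega by rewrite expr2; move: le; rewrite expr2; lra.
by rewrite -(ger0_norm m0) -sqrtr_sqr ler_wsqrtr.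
Qed.

Context {J Dx : nat}.
Variables (A : 'I_J.+1 -> 'M[R]_(n, Dx)) (abar : 'I_J.+1 -> 'cV[R]_n).
Variables (b : 'I_J.+1 -> 'cV[R]_Dx) (bbar : 'I_J.+1 -> R).
Let ell := loss A abar b bbar.

Lemma integrable_loss x : Q.-integrable setT (EFin \o ell x).
Proof.
set a := maxI (fun j => l2norm (A j *m x + abar j)).
have intg : Q.-integrable setT (EFin \o (fun xi => `|ell x 0| + a * l2norm xi)).
  exact: (integrableD measurableT (finite_measure_integrable_cst Q _ measurableT)
    (integrableZl measurableT a integrable_l2norm)).
apply: le_integrable intg => //.
  by apply/measurable_EFinP; exact: measurable_loss.
move=> xi _; rewrite !abse_EFin lee_fin; apply: le_trans (ler_norm _).
exact: loss_growth.
Qed.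

Lemma expected_lossE x : ('E_Q[ell x])%E = (\int[Q]_xi ell x xi)%:E.
Proof.
by rewrite unlock /Rintegral fineK//; exact: (integrable_fin_num measurableT (integrable_loss x)).
Qed.

(** Averaging [loss_dist_decision], whose slope is affine in [l2norm xi]; the
second-moment bound enters through [mean_l2norm_le]. *)
Lemma expected_loss_lipschitz x y :
  `|\int[Q]_xi ell x xi - \int[Q]_xi ell y xi| <=
  (maxI (fun j => opnorm (A j)) * Num.sqrt Omega + maxI (fun j => l2norm (b j)))
  * l2norm (x - y).
Proof.
set a := maxI _; set c := maxI _.
have a0 : 0 <= a by apply: maxI_ge0 => j; exact: opnorm_ge0.
have intB : Q.-integrable setT (EFin \o (fun xi => ell x xi - ell y xi)).
  exact: (integrableB measurableT (integrable_loss x) (integrable_loss y)).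
have intZ : Q.-integrable setT (EFin \o (fun xi => a * l2norm xi)).
  exact: (integrableZl measurableT a integrable_l2norm).
have intC := finite_measure_integrable_cst Q c measurableT.
have intD : Q.-integrable setT (EFin \o (fun xi => a * l2norm xi + c)).
  exact: (integrableD measurableT intZ intC).
rewrite -RintegralB//; try exact: integrable_loss.
apply: le_trans (le_normr_Rintegral measurableT intB) _.
apply: le_trans (_ : \int[Q]_xi ((a * l2norm xi + c) * l2norm (x - y)) <= _).
  apply: le_Rintegral => //; first exact: (integrable_norm intB).
    exact: (integrableZr measurableT _ intD).
  by move=> xi _; exact: loss_dist_decision.
rewrite RintegralZr// ler_wpM2r ?l2norm_ge0// RintegralD//.
rewrite RintegralZl//; last exact: integrable_l2norm.
have Q1 : fine (Q setT) = 1 by rewrite probability_setT.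
by rewrite Rintegral_cst// Q1 mulr1 lerD2r ler_wpM2l//; exact: mean_l2norm_le.
Qed.

End expected_loss.

(** * Pointwise consequence of a vanishing positive part *)

(** A function that is positive at a support point is bounded below by a
positive constant on a neighbourhood, which [Z] charges. *)
Lemma le0_of_integral_pospart_le0 (R : realType) n (X : set 'cV[R]_n)
    (Z : probability 'cV[R]_n R) (f : 'cV[R]_n -> R) :
  measurable X -> full_support_on X Z -> continuous f ->
  (\int[Z]_(z in X) maxe (f z)%:E 0 <= 0)%E -> forall z, X z -> f z <= 0.
Proof.
move=> mX [ZX1 suppX] cf int0 x Xx; rewrite leNgt; apply/negP => fx0.
set c := f x / 2; have c0 : 0 < c by rewrite divr_gt0.
pose U := f @^-1` [set r | c < r].
have oU : open U by move/continuousP: cf; apply; exact: open_gt.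
have mU := open_measurable_cV oU.
have ZU0 : (0 < Z U)%E.
  have : msupport Z x by rewrite suppX.
  by apply => //; rewrite /U /= /c; lra.
have ZXU0 : (0 < Z (X `&` U))%E.
  apply: lt_le_trans ZU0 _.
  have ZXC : Z (~` X) = 0 by rewrite probability_setC// ZX1 subee.
  rewrite -[leRHS]adde0 -ZXC.
  apply: le_trans (measureU2 _ (measurableI _ _ mX mU) (measurableC mX)).
  apply: le_measure; rewrite ?inE//.
    by apply: measurableU; [exact: measurableI|exact: measurableC].
  by move=> z Uz; have [Xz|nXz] := pselect (X z); [left|right].
have mf : measurable_fun X (fun z => maxe (f z)%:E 0).
  apply: measurable_maxe; last exact: measurable_cst.
  apply/measurable_EFinP; apply: measurable_funTS.
  exact: continuous_measurable_cV.
have := @le_integral_comp_abse _ _ _ Z X mX (fun z => maxe (f z)%:E 0) c id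
  (@measurable_id _ _ _) (fun r r0 => r0) (fun r s _ _ rs => rs) mf c0.
apply/negP; rewrite -ltNge.
under eq_integral do rewrite gee0_abs ?le_max ?lexx ?orbT//.
apply: le_lt_trans int0 _; rewrite mule_gt0 ?lte_fin//.
apply: lt_le_trans ZXU0 _; apply: le_measure; rewrite ?inE//.
- exact: measurableI.
- apply: emeasurable_fun_c_infty => //; exact: measurableT_comp mf.
- move=> z [Xz Uz]; split=> //=.
  rewrite gee0_abs ?le_max ?lexx ?orbT// lee_fin; apply/orP; left.
  exact: ltW.
Qed.

(** * Union bound *)

Section with_probability.
Context {R : realType} {d : measure_display} {T : measurableType d}.
Variable P : probability T R.
Implicit Types (A B : set T) (p q : R).

Lemma with_prob_ge_sub p A B :
  A `<=` B -> with_prob_ge P p A -> with_prob_ge P p B.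
Proof. by move=> AB [E mE [EA pE]]; exists E => //; split=> // w /EA /AB. Qed.

Lemma probability_ge_setC p E : measurable E ->
  ((1 - p)%:E <= P E)%E = (P (~` E) <= p%:E)%E.
Proof.
move=> mE; rewrite probability_setC// -(fineK (fin_num_measure P E mE)).
by rewrite -EFinB !lee_fin; apply/idP/idP; lra.
Qed.

Lemma with_prob_ge_ae (S : T -> Prop) : {ae P, forall w, S w} ->
  with_prob_ge P (1 - 0) [set w | S w].
Proof.
move=> [N [mN PN0 SN]]; exists (~` N); first exact: measurableC.
split; last by rewrite probability_ge_setC ?setCK ?PN0//; exact: measurableC.
by move=> w; apply: contra_notP => /SN.
Qed.

Lemma with_prob_geI p q A B : with_prob_ge P (1 - p) A ->
  with_prob_ge P (1 - q) B -> with_prob_ge P (1 - (p + q)) (A `&` B).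
Proof.
move=> [E mE [EA pE]] [F mF [FB qF]]; exists (E `&` F); first exact: measurableI.
split; first exact: setISS.
move: pE qF; rewrite !probability_ge_setC//; last exact: measurableI.
move=> pE qF; rewrite setCI EFinD; apply: le_trans (leeD pE qF).
by apply: measureU2; exact: measurableC.
Qed.

Lemma with_prob_ge_union_bound K p (A : 'I_K -> set T) :
  (forall i, with_prob_ge P (1 - p) (A i)) ->
  with_prob_ge P (1 - K%:R * p) [set w | forall i, A i w].
Proof.
elim: K A => [|K IH] A hA.
  by rewrite mul0r; apply: with_prob_ge_ae; apply: aeW => w [].
have := with_prob_geI (hA ord0) (IH _ (fun i => hA (lift ord0 i))).
rewrite -natr1 mulrDl mul1r (addrC (_ * p)); apply: with_prob_ge_sub.
move=> w [A0 AS] i; have [j|] := unliftP ord0 i; last by move=> ->.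
by move=> ->; exact: AS.
Qed.

End with_probability.

(** * Out-of-sample guarantee *)

Theorem theorem1 (R : realType) (Dx Dxi J N : nat) (hN : (0 < N)%N)
  (* decision set, support set and piecewise affine loss *)
  (X : set 'cV[R]_Dx) (hXcompact : compact X) (hXconvex : convex_set X)
  (Xi : set 'cV[R]_Dxi) (hXi : measurable Xi)
  (A : 'I_J.+1 -> 'M[R]_(Dxi, Dx)) (abar : 'I_J.+1 -> 'cV[R]_Dxi)
  (b : 'I_J.+1 -> 'cV[R]_Dx) (bbar : 'I_J.+1 -> R)
  (ell : 'cV[R]_Dx -> 'cV[R]_Dxi -> R) (hell : ell = loss A abar b bbar)
  (c1 c2 : R) (hc1 : 0 <= c1) (hc2 : 0 <= c2)
  (hgrowth : forall x xi, X x -> Xi xi -> `|ell x xi| <= c1 + c2 * l2norm xi)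
  (* true distribution *)
  (Pstar : probability 'cV[R]_Dxi R) (hPstar : Pstar Xi = 1%E)
  (* random data points and the reference distribution built from them *)
  (d : measure_display) (T : measurableType d) (Pr : probability T R)
  (d' : measure_display) (D : measurableType d')
  (data : 'I_N -> {mfun T >-> D})
  (ref : ('I_N -> D) -> probability 'cV[R]_Dxi R)
  (href : forall s, ref s Xi = 1%E)
  (Phat : T -> probability 'cV[R]_Dxi R)
  (hPhat : forall w, Phat w = ref (fun i => data i w))
  (* second-moment bound *)
  (Omega : R) (hOmega_hat : {ae Pr, forall w, (second_moment (Phat w) < Omega%:E)%E})
  (hOmega_star : (second_moment Pstar <= Omega%:E)%E)
  (* exploration distribution *)
  (Z : probability 'cV[R]_Dx R) (hZ : full_support_on X Z)
  (* pointwise concentration *)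
  (Rx : R) (hRx : forall x, X x -> l2norm x <= Rx)
  (rate : R -> R) (hrate_ge0 : forall t, 0 <= t -> 0 <= rate t)
  (hrate_mono : forall s t, 0 <= s -> s <= t -> rate s <= rate t)
  (hrate_growth : poly_growth rate)
  (hconc : forall z, X z -> forall eta : R, 0 < eta < 1 ->
     with_prob_ge Pr (1 - eta)
       [set w | (`|'E_Pstar[ell z] - 'E_(Phat w)[ell z]|
                 <= ((Num.sqrt N%:R)^-1 * rate (ln eta^-1))%:E)%E])
  (* constants *)
  (L : R) (hL : L = maxI (fun j => opnorm (A j)) * Num.sqrt Omega
                    + maxI (fun j => l2norm (b j)))
  (delta : R) (hdelta : 0 < delta < 1)
  (eps : R)
  (heps : eps = (Num.sqrt N%:R)^-1
     * (rate (Dx%:R * ln (1 + 2 * Rx * L * Num.sqrt N%:R) + ln delta^-1) + 2))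
  (* minimizers *)
  (xstar : 'cV[R]_Dx) (hxstar : argmin X (fun x => 'E_Pstar[ell x])%E xstar)
  (xhat : T -> 'cV[R]_Dx)
  (hxhat : {ae Pr, forall w, argmin X
     (fun x => ereal_sup
        [set ('E_Q[ell x])%E | Q in ambiguity_set X Xi Z ell (Phat w) Omega eps])
     (xhat w)}) :
  with_prob_ge Pr (1 - 2 * delta)
    [set w | ('E_Pstar[ell (xhat w)] <=
              'E_Pstar[ell xstar]
              + ((Num.sqrt N%:R)^-1 * rate (ln delta^-1) + eps)%:E)%E].
Proof.
subst ell; set ell := loss A abar b bbar.
move: hdelta => /andP[delta0 delta1].
have [Xxs xs_min] := hxstar.
set t := Num.sqrt N%:R; have t0 : 0 < t by rewrite sqrtr_gt0 ltr0n.
have L0 : 0 <= L.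
  rewrite hL addr_ge0// ?mulr_ge0 ?sqrtr_ge0// maxI_ge0// => j.
    exact: opnorm_ge0.
  exact: l2norm_ge0.
have [K [x [Kle Xx net]]] := exists_lipschitz_net L0 t0 Xxs hRx.
have K_gt0 : (0 < K)%N by have [i _] := net _ Xxs; apply: leq_ltn_trans (ltn_ord i).
have KR_gt0 : 0 < K%:R :> R by rewrite ltr0n.
have K_ge1 : 1 <= K%:R :> R by rewrite ler1n.
set rnet := rate (Dx%:R * ln (1 + 2 * Rx * L * t) + ln delta^-1).
have ln_delta : 0 <= ln delta^-1 by rewrite ln_ge0// invf_ge1// ltW.
have etaK : 0 < delta / K%:R < 1.
  by rewrite divr_gt0// ltr_pdivrMr// mul1r (lt_le_trans delta1).
have base0 : 0 < 1 + 2 * Rx * L * t.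
  have Rx0 : 0 <= Rx := le_trans (l2norm_ge0 xstar) (hRx _ Xxs).
  by rewrite ltr_pwDl// !mulr_ge0// ltW.
(* The union bound over K points is run at level delta / K. *)
have rate_le : rate (ln (delta / K%:R)^-1) <= rnet.
  rewrite invf_div lnM ?posrE ?invr_gt0//; apply: hrate_mono.
    by rewrite addr_ge0// ln_ge0.
  rewrite lerD2r mulr_natl -lnXn// ler_ln ?posrE//.
  exact: exprn_gt0.
have net_good := with_prob_ge_union_bound (fun i => hconc _ (Xx i) _ etaK).
have := with_prob_geI (with_prob_ge_ae hOmega_hat)
  (with_prob_geI (with_prob_ge_ae hxhat)
    (with_prob_geI net_good (hconc _ Xxs _ (introT andP (conj delta0 delta1))))).
rewrite !add0r (mulrC K%:R) divfK ?lt0r_neq0// -mulr2n -(mulr_natl delta).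
apply: with_prob_ge_sub => w [/= /ltW moment [[Xxh xh_min] [netw xsw]]].
pose mS z := \int[Pstar]_xi ell z xi.
pose mH z := \int[Phat w]_xi ell z xi.
have mSE z : ('E_Pstar[ell z])%E = (mS z)%:E := expected_lossE hOmega_star _ _ _ _ z.
have mHE z : ('E_(Phat w)[ell z])%E = (mH z)%:E := expected_lossE moment _ _ _ _ z.
have mS_lip y z : `|mS y - mS z| <= L * l2norm (y - z).
  by rewrite hL; exact: expected_loss_lipschitz.
have mH_lip y z : `|mH y - mH z| <= L * l2norm (y - z).
  by rewrite hL; exact: expected_loss_lipschitz.
have Pstar_amb : ambiguity_set X Xi Z ell (Phat w) Omega eps Pstar.
  split=> //; rewrite integral0_eq// => z Xz.
  have [i zi] := net _ Xz.
  have /= := netw i; rewrite mSE mHE -EFinB abse_EFin lee_fin => close.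
  rewrite mSE mHE -!EFinB; apply/max_idPr; rewrite lee_fin heps -/t -/rnet.
  (* Transfer from the net point x i: each risk moves by at most 1 / t. *)
  have := mS_lip z (x i); have := mH_lip z (x i).
  have close' : `|mS (x i) - mH (x i)| <= t^-1 * rnet.
    by apply: le_trans close _; rewrite ler_wpM2l// invr_ge0 ltW.
  by move: zi close'; rewrite !ler_norml mulrDr; lra.
have amb_le Q : ambiguity_set X Xi Z ell (Phat w) Omega eps Q ->
    ('E_Q[ell xstar] <= (mH xstar + eps)%:E)%E.
  move=> [_ int0 momentQ].
  pose mQ z := \int[Q]_xi ell z xi.
  have mQE z : ('E_Q[ell z])%E = (mQ z)%:E := expected_lossE momentQ _ _ _ _ z.
  have mQ_lip y z : `|mQ y - mQ z| <= L * l2norm (y - z).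
    by rewrite hL; exact: expected_loss_lipschitz.
  have cont : continuous (fun z => mQ z - mH z - eps).
    apply: (@lipschitz_continuous_cV _ _ _ (L + L)) => y z.
    by have := mQ_lip y z; have := mH_lip y z; rewrite !ler_norml; lra.
  have int0' : (\int[Z]_(z in X) maxe (mQ z - mH z - eps)%:E 0 <= 0)%E.
    apply: le_trans int0; rewrite le_eqVlt; apply/orP; left; apply/eqP.
    by apply: eq_integral => z _; rewrite mQE mHE -!EFinB.
  have := le0_of_integral_pospart_le0 (compact_measurable_cV hXcompact) hZ cont
    int0' Xxs.
  by rewrite mQE lee_fin; lra.
have : ('E_Pstar[ell (xhat w)] <= (mH xstar + eps)%:E)%E.
  apply: le_trans (_ : _ <= ereal_sup [set ('E_Q[ell (xhat w)])%E
    | Q in ambiguity_set X Xi Z ell (Phat w) Omega eps])%E _.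
    by apply: ereal_sup_ubound; exists Pstar.
  apply: le_trans (xh_min _ Xxs) _.
  by apply: ge_ereal_sup => _ [Q ambQ <-]; exact: amb_le.
move: xsw; rewrite !mSE mHE -EFinB abse_EFin !lee_fin -/t => xsw.
by move: xsw; rewrite ler_norml => /andP[]; lra.
Qed.
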